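(* Let $\mathcal{A} \subseteq B(\mathcal{H})$ be a dual operator algebra with no full subquotients of dimension greater than $1$. If the transitive algebra problem has a positive solution, then there is a maximal nest in $\mathcal{H}$ with respect to which $\mathcal{A}$ is upper triangular.
   Context: $\mathcal{H}$ is a complex Hilbert space. A dual operator algebra is a weak* closed complex linear subspace of $B(\mathcal{H})$ which is closed under products (not necessarily unital or self-adjoint). A closed subspace $\mathcal{E}\subseteq\mathcal{H}$ is invariant for $\mathcal{A}$ if $A(\mathcal{E})\subseteq\mathcal{E}$ for all $A\in\mathcal{A}$; it is semi-invariant if $\mathcal{E}=\mathcal{E}_1\cap\mathcal{E}_2^\perp$ for some invariant subspaces $\mathcal{E}_2\subseteq\mathcal{E}_1$. If $P$ is the orthogonal projection onto a semi-invariant subspace $\mathcal{E}$, the weak* closure $\overline{P\mathcal{A}P}^{wk*}\subseteq B(\mathcal{E})$ is called a subquotient of $\mathcal{A}$ (it is a dual operator algebra in $B(\mathcal{E})$); it is full if it equals $B(\mathcal{E})$. Having no full subquotients of dimension greater than $1$ means that $\overline{P\mathcal{A}P}^{wk*}\neq B(\mathcal{E})$ whenever $\mathcal{E}$ is semi-invariant with $\dim\mathcal{E}>1$. The transitive algebra problem asks whether, for every complex Hilbert space $\mathcal{K}$ of dimension greater than $1$, every dual operator algebra properly contained in $B(\mathcal{K})$ has a nontrivial invariant subspace (an invariant closed subspace other than $\{0\}$ and $\mathcal{K}$); a positive solution means that the answer is yes. A nest in $\mathcal{H}$ is a family of closed subspaces totally ordered by inclusion; it is maximal if it is not properly contained in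 any other nest. $\mathcal{A}$ is upper triangular for a nest if each subspace in the nest is invariant for $\mathcal{A}$. *)

(* Defs.v *)
From HB Require Import structures.
From mathcomp Require Import all_boot all_order all_algebra.
From mathcomp Require Import sesquilinear complex.
From mathcomp Require Import all_classical all_reals all_analysis.

Set Implicit Arguments.
Unset Strict Implicit.
Unset Printing Implicit Defensive.

Import Order.TTheory GRing.Theory Num.Theory.
Import numFieldNormedType.Exports.

Local Open Scope classical_set_scope.
Local Open Scope complex_scope.
Local Open Scope ring_scope.

(* [{dot H for Num.conj}] is linear in its first argument and conjugate-linear
   in the second one. *)
HB.mixin Record isHilbert (R : realType) H & CompleteNormedModule R[i] H := {
  dotp : {dot H for (@Num.conj R[i])} ;
  dotp_norm : forall x : H, dotp x x = `|x| ^+ 2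
}.

#[short(type="hilbertType")]
HB.structure Definition Hilbert (R : realType) :=
  {H of CompleteNormedModule R[i] H & isHilbert R H}.

Section BoundedOperators.
Context {R : realType} (H : hilbertType R).

Definition bounded_op : {pred H -> H} :=
  [pred f : H -> H |
    `[< linear f /\ exists M : R[i], forall x, `|f x| <= M * `|x| >]].

Lemma bounded_op_submod : GRing.submod_closed bounded_op.
Proof.
split=> [|a f g /asboolP[fl [M fM]] /asboolP[gl [N gN]]]; apply/asboolP.
  split=> [b x y|]; first by rewrite scaler0 addr0.
  by exists 0 => x; rewrite mul0r normr0.
split=> [b x y|].
  change (a *: f (b *: x + y) + g (b *: x + y) =
    b *: (a *: f x + g x) + (a *: f y + g y)).
  rewrite fl gl !scalerDr !scalerA -!addrA; congr (_ + _); first by rewrite mulrC.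
  by rewrite addrCA.
exists (`|a| * M + N) => x; rewrite mulrDl.
apply: le_trans (ler_normD _ _) _; apply: lerD; last exact: gN.
by rewrite normrZ -mulrA ler_wpM2l.
Qed.

HB.instance Definition _ :=
  GRing.isSubmodClosed.Build _ _ bounded_op bounded_op_submod.

Record bop := Bop { bop_fun :> H -> H ; bop_bounded : bop_fun \in bounded_op }.

HB.instance Definition _ := [isSub for bop_fun].
HB.instance Definition _ := [Choice of bop by <:].
HB.instance Definition _ := [SubChoice_isSubLmodule of bop by <:].

Lemma bop_comp_bounded (S T : bop) : S \o T \in bounded_op.
Proof.
case: S T => [f /asboolP[fl [M fM]]] [g /asboolP[gl [N gN]]] /=.
apply/asboolP; split=> [a x y|] /=; first by rewrite gl fl.
exists (`|M| * N) => x; apply: le_trans (fM _) _.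
have -> : M * `|g x| = `|M| * `|g x|.
  have := le_trans (normr_ge0 _) (fM (g x)).
  by move/ger0_norm => <-; rewrite normrM normr_id.
by rewrite -mulrA ler_wpM2l.
Qed.

Definition bop_comp (S T : bop) : bop := Bop (bop_comp_bounded S T).

End BoundedOperators.

Definition is_subspace (K : pzRingType) (V : lmodType K) (A : set V) : Prop :=
  A 0 /\ forall (a : K) (x y : V), A x -> A y -> A (a *: x + y).

Record csub (R : realType) (H : hilbertType R) := CSub {
  csub_set :> set H ;
  csub_subspace : is_subspace csub_set ;
  csub_closed : closed csub_set }.

(* A closed subspace [E] of [H] is a Hilbert space [csub_sort E] in its own
   right, for the operations and the inner product of [H]. *)
Section ClosedSubspaceHilbert.
Context {R : realType} {H : hilbertType R} (E : csub H).

Definition csub_pred : {pred H} := mem (csub_set E).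

Lemma csub_submod : GRing.submod_closed csub_pred.
Proof.
have [E0 EL] := csub_subspace E.
split=> [|a x y]; rewrite !inE; [exact: E0 | exact: EL].
Qed.

HB.instance Definition _ :=
  GRing.isSubmodClosed.Build _ _ csub_pred csub_submod.

Record csub_sort := CSubSort {
  csub_val :> H ; csub_valP : csub_val \in csub_pred }.

HB.instance Definition _ := [isSub for csub_val].
HB.instance Definition _ := [Choice of csub_sort by <:].
HB.instance Definition _ := [SubChoice_isSubLmodule of csub_sort by <:].

Let norm (x : csub_sort) : R[i] := `|csub_val x|.

Let ler_normD x y : norm (x + y) <= norm x + norm y.
Proof. exact: ler_normD. Qed.

Let normrZ (a : R[i]) x : norm (a *: x) = `|a| * norm x.
Proof. exact: normrZ. Qed.

Let normr0_eq0 x : norm x = 0 -> x = 0.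
Proof. by move/normr0_eq0 => x0; apply: val_inj. Qed.

HB.instance Definition _ :=
  Lmodule_isNormed.Build R[i] csub_sort ler_normD normrZ normr0_eq0.

Lemma csub_complete (F : set_system csub_sort) :
  ProperFilter F -> cauchy F -> cvg F.
Proof.
move=> FF /cauchy_ballP Fc.
have /cauchy_cvg Gcvg : cauchy (csub_val @ F).
  apply/cauchy_ballP => e e0; have := Fc _ e0.
  rewrite !near_simpl near2E => -[[A B] /= [FA FB] AB].
  exists (csub_val @` A, csub_val @` B) => /=.
    split; [apply: filterS FA | apply: filterS FB] => x Ax /=; by exists x.
  move=> [_ _] /= [[x Ax <-] [y By <-]]; have := AB (x, y) (conj Ax By).
  by rewrite /= -!ball_normE.
have [l Gl] : exists l : H, csub_val @ F --> l by apply: (@cvg_ex H _).1; exact: Gcvg.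
have El : l \in csub_pred.
  rewrite inE; apply: csub_closed => B /Gl FB.
  have {}FB : F (csub_val @^-1` B) by exact: FB.
  have [x Bx] := filter_ex FB; exists (csub_val x); split => //.
  by have := csub_valP x; rewrite inE.
apply/cvg_ex; exists (CSubSort El); apply/cvgrPdist_lt => e e0.
by move/cvgrPdist_lt : Gl => /(_ _ e0).
Qed.

HB.instance Definition _ := Uniform_isComplete.Build csub_sort csub_complete.

Definition csub_dotp (x y : csub_sort) : R[i] := dotp (csub_val x) (csub_val y).

Let csub_dotp_bilinear :
  bilinear_for (GRing.Scale.Law.clone _ _ ( *%R ) _)
    (GRing.Scale.Law.clone _ _ (@Num.conj R[i] \; *%R) _) csub_dotp.
Proof.
split=> [z|z] a x y; rewrite /csub_dotp /=.
  by rewrite linearDl linearZl_LR.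
by rewrite linearD linearZ.
Qed.

HB.instance Definition _ := bilinear_isBilinear.Build R[i] csub_sort csub_sort _
 _ _ csub_dotp csub_dotp_bilinear.

Let csub_dotp_hermitian x y : 
  csub_dotp x y = (-1) ^+ false * Num.conj (csub_dotp y x).
Proof. exact: hermitian_subproof. Qed.

HB.instance Definition _ := isHermitianSesquilinear.Build R[i] csub_sort
  false _ csub_dotp csub_dotp_hermitian.

Let csub_dotp_gt0 (x : csub_sort) : x != 0 -> 0 < csub_dotp x x.
Proof. by move=> x0; apply: neq0_dnorm_gt0. Qed.

HB.instance Definition _ := isDotProduct.Build R[i] csub_sort csub_dotp
  csub_dotp_gt0.

Let csub_dotp_norm (x : csub_sort) : csub_dotp x x = `|x| ^+ 2.
Proof. exact: dotp_norm. Qed.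

HB.instance Definition _ := isHilbert.Build R csub_sort csub_dotp_norm.

End ClosedSubspaceHilbert.

Definition orthocomp (R : realType) (H : hilbertType R) (E : set H) : set H :=
  [set x | forall y, E y -> dotp x y = 0].

(* By the projection theorem, [x] is in the sum of the closed subspace [E] and
   its orthogonal complement, and the point chosen here is the only one: the
   default value of [xget] is never used. *)
Definition orth_proj (R : realType) (H : hilbertType R) (E : csub H) (x : H) : H :=
  xget 0 [set p | csub_set E p /\ orthocomp E (x - p)].

Definition dim_gt1 (K : pzRingType) (V : lmodType K) : Prop :=
  exists x y : V, forall a b : K, a *: x + b *: y = 0 -> a = 0 /\ b = 0.

Section OperatorAlgebras.
Context {R : realType} {H : hilbertType R}.
Implicit Types (A : set (bop H)) (E : csub H).

Definition l2seq : Type :=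
  {u : nat -> H | cvgn (series (fun n => `|u n| ^+ 2))}.

(* The elements of the predual of B(H) are the functionals
     T |-> \sum_n <T u_n, v_n>  with  \sum_n |u_n|^2, \sum_n |v_n|^2 < oo,
   i.e. T |-> tr (T C) for the trace-class operators C = \sum_n <-, v_n> u_n;
   the weak* topology is the topology of pointwise convergence on them. *)
Definition predual_eval (T : bop H) : {ptws l2seq * l2seq -> (R[i])^o} :=
  fun uv => limn (series (fun n => dotp (T (sval uv.1 n)) (sval uv.2 n))).

Definition weak_star : Type := initial_topology predual_eval.

HB.instance Definition _ :=
  Topological.copy weak_star (initial_topology predual_eval).

Definition dual_operator_algebra A : Prop :=
  [/\ is_subspace A,
      forall S T, A S -> A T -> A (bop_comp S T) &
      closed (A : set weak_star)].

Definition invariant_subspace A E : Prop :=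
  forall T, A T -> T @` (E : set H) `<=` E.

Definition semi_invariant A E : Prop :=
  exists E1 E2 : csub H,
    [/\ invariant_subspace A E1, invariant_subspace A E2, E2 `<=` E1 &
        (E : set H) = E1 `&` orthocomp E2].

(* P A P as a set of operators on [E], with P the projection onto [E]; the
   right-hand P is the identity on [E]. *)
Definition compression A E : set (bop (csub_sort E)) :=
  [set S | exists2 T, A T &
     forall x : csub_sort E, csub_val (S x) = orth_proj E (T (csub_val x))].

Definition nest (N : set (csub H)) : Prop :=
  forall E F, N E -> N F -> E `<=` F \/ F `<=` E.

Definition maximal_nest (N : set (csub H)) : Prop :=
  nest N /\ forall M, nest M -> N `<=` M -> M = N.

Definition upper_triangular A (N : set (csub H)) : Prop :=
  forall E, N E -> invariant_subspace A E.

End OperatorAlgebras.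

Arguments weak_star {R} H.
Arguments compression {R H} A E _ : rename.

Definition subquotient (R : realType) (H : hilbertType R) (A : set (bop H))
    (E : csub H) : set (bop (csub_sort E)) :=
  closure (compression A E : set (weak_star (csub_sort E))).

Arguments subquotient {R H} A E _ : rename.

Definition no_full_subquotient_dim_gt1 (R : realType) (H : hilbertType R)
    (A : set (bop H)) : Prop :=
  forall E : csub H, semi_invariant A E -> dim_gt1 (csub_sort E) ->
    subquotient A E <> setT.

Definition transitive_algebra_problem_positive (R : realType) : Prop :=
  forall (K : hilbertType R) (A : set (bop K)),
    dim_gt1 K -> dual_operator_algebra A -> A `<` setT ->
    exists E : csub K, [/\ invariant_subspace A E, (E : set K) <> [set 0] &
      (E : set K) <> setT].

(* Main.v *)
(* By Zorn, take a family N of invariant subspaces that is maximal among the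
   nests of invariant subspaces.  If N is not maximal among all nests, some
   subspace F outside N is comparable with every member of N.  Let E1 be the
   intersection of the members of N above F and E2 the closed span of those
   below F; both belong to N, and F lies strictly between them, so the
   semi-invariant subspace E1 n E2^perp has dimension at least 2.  Its
   subquotient is a dual operator algebra which is not full, hence has a
   nontrivial invariant subspace G, and the closed span of E2 and G is an
   invariant subspace strictly between E2 and E1 that can be added to N. *)
Require Import Defs.
From HB Require Import structures.
From mathcomp Require Import all_boot all_order all_algebra.
From mathcomp Require Import sesquilinear complex.
From mathcomp Require Import all_classical all_reals all_analysis.
From mathcomp Require Import ring lra.

Set Implicit Arguments.
Unset Strict Implicit.
Unset Printing Implicit Defensive.

Import Order.TTheory GRing.Theory Num.Theory.
Import numFieldNormedType.Exports.

Local Open Scope classical_set_scope.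
Local Open Scope ring_scope.

(** * Completeness of the complex numbers *)

Lemma complex_cauchy_cvg (R : realType) (u : nat -> R[i]^o) :
  cauchy (u @ \oo) -> cvgn u.
Proof.
move=> /cauchy_ballP uc.
(* An additive map dominated by the modulus preserves Cauchy sequences; [Re] and [Im] are two
   instances. *)
have part (f : {additive R[i] -> R}) : (forall z, `|f z|%:C <= `|z|)%C ->
    cvgn (f \o u).
  move=> fle; apply/cauchy_cvgP/cauchy_ballP => e e0.
  have e0' : 0 < e%:C%C :> R[i] by rewrite ltcR.
  have := uc _ e0'; rewrite !near_simpl !near2E => -[[P Q] /= [FP FQ] PQ].
  exists (P, Q) => //= -[m n] /= mn; have := PQ (m, n) mn.
  rewrite -!ball_normE /= => uvn; rewrite -ltcR; apply: le_lt_trans uvn.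
  by rewrite -raddfB; exact: fle.
have [a ua] : exists a : R, (@complex.Re R \o u) @ \oo --> a.
  by apply: (@cvg_ex R _).1; exact: (part (@complex.Re R)) (@normc_ge_Re R).
have imle (z : R[i]) : (`|complex.Im z|%:C <= `|z|)%C.
  have := normc_ge_Re (z * 'i%C); rewrite ReiNIm normrN normrM.
  by rewrite [`|'i%C|]normc_def /= expr0n expr1n add0r sqrtr1 mulr1.
have [b ub] : exists b : R, (@complex.Im R \o u) @ \oo --> b.
  by apply: (@cvg_ex R _).1; exact: (part (@complex.Im R)) imle.
apply/cvg_ex; exists (a%:C + 'i * b%:C)%C.
apply/cvgrPdist_lt => e e0.
(* A positive element of [R[i]] is real, so estimates can be carried out in [R]. *)
have rE : (complex.Re e)%:C%C = e by apply: RRe_real; exact: gtr0_real.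
have r0 : 0 < complex.Re e / 2 by rewrite divr_gt0// -ltcR rE.
near=> n.
have -> : (a%:C + 'i * b%:C)%C - u n =
    ((a - complex.Re (u n))%:C + 'i * (b - complex.Im (u n))%:C)%C.
  by rewrite {1}(complexE (u n)) !rmorphB mulrBr opprD addrACA.
apply: le_lt_trans (ler_normD _ _) _.
rewrite normrM [`|'i%C|]normc_def /= expr0n expr1n add0r sqrtr1 mul1r.
rewrite !normc_def /= !expr0n !addr0 !sqrtr_sqr.
rewrite -rmorphD -rE ltcR [ltRHS]splitr; apply: ltrD; near: n.
- by move/cvgrPdist_lt : ua; exact.
- by move/cvgrPdist_lt : ub; exact.
Unshelve. all: by end_near. Qed.

(** * Inner product identities and the Cauchy-Schwarz inequality *)

Section InnerProduct.
Context {R : realType} {H : hilbertType R}.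
Implicit Types (x y z : H) (a : R[i]).

Lemma dotpDl x y z : dotp (x + y) z = dotp x z + dotp y z.
Proof. by rewrite linearDl. Qed.

Lemma dotpBl x y z : dotp (x - y) z = dotp x z - dotp y z.
Proof. by rewrite linearBl. Qed.

Lemma dotpZl a x y : dotp (a *: x) y = a * dotp x y.
Proof. by rewrite linearZl_LR. Qed.

Lemma dotpDr x y z : dotp x (y + z) = dotp x y + dotp x z.
Proof. by rewrite linearD. Qed.

Lemma dotpBr x y z : dotp x (y - z) = dotp x y - dotp x z.
Proof. by rewrite linearB. Qed.

Lemma dotpZr a x y : dotp x (a *: y) = Num.conj a * dotp x y.
Proof. by rewrite linearZ. Qed.

Lemma dotpC x y : dotp x y = Num.conj (dotp y x).
Proof. by rewrite hermC expr0 mul1r. Qed.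

Lemma dotp0l x : dotp 0 x = 0.
Proof. by rewrite linear0l. Qed.

Lemma dotp0r x : dotp x 0 = 0.
Proof. by rewrite linear0r. Qed.

Lemma dotp_ge0 x : 0 <= dotp x x.
Proof. by rewrite dotp_norm exprn_ge0. Qed.

Lemma dotp_eq0 x : dotp x x = 0 -> x = 0.
Proof. by rewrite dotp_norm => /eqP; rewrite sqrf_eq0 normr_eq0 => /eqP. Qed.

Lemma dotp_eq0C x y : dotp x y = 0 -> dotp y x = 0.
Proof. by rewrite dotpC => /(congr1 Num.conj); rewrite conjCK conjC0. Qed.

(** This is the squared distance from [x] to the line through [y], attained at the projection of [x]
    on that line. *)
Lemma dotp_min x y : y != 0 ->
  dotp (x - (dotp x y / dotp y y) *: y) (x - (dotp x y / dotp y y) *: y) =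
  dotp x x - `|dotp x y| ^+ 2 / dotp y y.
Proof.
move=> y0; have yy : dotp y y != 0 by apply: contraNneq y0 => /dotp_eq0 ->.
rewrite dotpBl dotpZl !dotpBr !dotpZr mulrBr.
set c := dotp x y; set d := dotp y y.
have -> : dotp y x = Num.conj c by rewrite dotpC.
have -> : Num.conj (c / d) = Num.conj c / d.
  by rewrite rmorphM fmorphV /= -[Num.conj d]dotpC.
by rewrite normCK; field.
Qed.

Lemma cauchy_schwarz x y : `|dotp x y| <= `|x| * `|y|.
Proof.
have [->|y0] := eqVneq y 0; first by rewrite dotp0r !normr0 mulr0.
have := dotp_ge0 (x - (dotp x y / dotp y y) *: y).
rewrite dotp_min// !dotp_norm subr_ge0 ler_pdivrMr ?exprn_gt0 ?normr_gt0//.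
by rewrite -exprMn ler_pXn2r // nnegrE ?mulr_ge0.
Qed.

Lemma parallelogram x y :
  dotp (x + y) (x + y) + dotp (x - y) (x - y) = 2 * (dotp x x + dotp y y).
Proof.
rewrite dotpDl dotpBl !dotpBr !dotpDr.
ring.
Qed.

Lemma dotp_continuousl y : continuous ((fun x => dotp x y) : H -> R[i]^o).
Proof.
move=> x; apply/cvgrPdist_lt => e e0.
near=> t.
rewrite -dotpBl; apply: le_lt_trans (cauchy_schwarz _ _) _.
(* Adding 1 keeps the divisor positive when [y] is zero. *)
apply: (@le_lt_trans _ _ (`|x - t| * (`|y| + 1))).
  by rewrite ler_wpM2l// lerDl.
rewrite -ltr_pdivlMr ?ltr_wpDl//.
near: t; apply: cvgr_dist_lt => //; by rewrite divr_gt0 ?ltr_wpDl.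
Unshelve. all: by end_near. Qed.

End InnerProduct.

(** * Orthogonal projection onto a closed subspace *)

Section Projection.
Context {R : realType} {H : hilbertType R} (E : csub H).
Implicit Types (x y z : H) (a : R[i]).

Lemma csub0 : csub_set E 0.
Proof. by have [] := csub_subspace E. Qed.

Lemma csubP a x y : csub_set E x -> csub_set E y -> csub_set E (a *: x + y).
Proof. by have [_] := csub_subspace E; exact. Qed.

Lemma csubD x y : csub_set E x -> csub_set E y -> csub_set E (x + y).
Proof. by move=> Ex Ey; rewrite -[x]scale1r; exact: csubP. Qed.

Lemma csubZ a x : csub_set E x -> csub_set E (a *: x).
Proof. by move=> Ex; rewrite -[_ *: _]addr0; apply: csubP => //; exact: csub0. Qed.

Lemma csubB x y : csub_set E x -> csub_set E y -> csub_set E (x - y).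
Proof. by move=> Ex Ey; rewrite addrC -scaleN1r; exact: csubP. Qed.

(* By the parallelogram identity, the sets of nearly closest points of E form a
   Cauchy filter. *)
Lemma orth_decomp_ex x : exists p, csub_set E p /\ orthocomp E (x - p).
Proof.
pose q y := dotp (x - y) (x - y); pose rq y := complex.Re (q y).
have rqE y : (rq y)%:C%C = q y by apply: RRe_real; exact/ger0_real/dotp_ge0.
pose V := [set rq y | y in E]; pose D := inf V.
have V0 : lbound V 0.
  by move=> _ [y _ <-]; rewrite -lecR rqE; exact: dotp_ge0.
have DV y : csub_set E y -> D <= rq y.
  by move=> Ey; apply: ge_inf; [exists 0|exists y].
have Dadh (e : R) : 0 < e -> exists y, csub_set E y /\ rq y < D + e.
  move=> e0; have [|_ [y Ey <-] ye] := @inf_adherent _ V e e0.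
    by split; [exists (rq 0), 0 => //; exact: csub0|exists 0].
  by exists y.
pose F := filter_from [set e : R | 0 < e]
  (fun e => [set y | csub_set E y /\ rq y < D + e]).
have FF : ProperFilter F.
  apply: filter_from_proper; last by move=> e /Dadh[y Ey]; exists y.
  apply: filter_from_filter; first by exists 1 => /=.
  move=> e1 e2 /= e10 e20; exists (Num.min e1 e2); first by rewrite /= lt_min e10.
  by move=> y [Ey]; rewrite -ltrBlDl lt_min !ltrBlDl => /andP[].
have near_min (e : R) y z : csub_set E y -> csub_set E z ->
    rq y < D + e -> rq z < D + e ->
    dotp (y - z) (y - z) < (4 * e)%:C%C.
  (* The midpoint [w] of [y] and [z] lies in [E], so [D <= rq w], and the parallelogram identity
     bounds the squared distance by 2 (2D + 2e) - 4D = 4e. *)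
  move=> Ey Ez ye ze; have := parallelogram (x - y) (x - z).
  have -> : x - y - (x - z) = - (y - z) by rewrite opprB addrC addrA subrK opprB.
  have -> : x - y + (x - z) = 2 *: (x - 2^-1 *: (y + z)).
    rewrite scalerBr scalerA divff// scale1r scaler_nat mulr2n opprD.
    by rewrite addrACA.
  rewrite dotpZl dotpZr linearNl linearNr /= opprK conjC_nat mulrA.
  have := DV _ (csubZ 2^-1 (csubD Ey Ez)); set w := 2^-1 *: _ => Dw.
  rewrite -/(q w) -/(q y) -/(q z) -!rqE => /(canRL (addKr _)) ->.
  have -> : 2 * 2 = (4%:R)%:C%C :> R[i] by rewrite -natrM rmorph_nat.
  have -> : 2 = (2%:R)%:C%C :> R[i] by rewrite rmorph_nat.
  rewrite -!(rmorphN, rmorphM, rmorphD) ltcR.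
 lra.
have Fc : cauchy F.
  apply: cauchy_exP => e e0.
  have rE : (complex.Re e)%:C%C = e by apply: RRe_real; exact: gtr0_real.
  have r0 : 0 < complex.Re e by rewrite -ltcR rE.
  (* Chosen so that the bound [4 * e] of [near_min] becomes the square of the wanted radius. *)
  have d0 : 0 < complex.Re e ^+ 2 / 4 by rewrite divr_gt0// exprn_gt0.
  have [y [Ey ye]] := Dadh _ d0.
  exists y, (complex.Re e ^+ 2 / 4) => // z [Ez ze].
  rewrite -ball_normE /=.
  have := near_min _ _ _ Ey Ez ye ze.
  rewrite dotp_norm mulrC divfK// rmorphXn /= rE ltr_pXn2r// ?nnegrE//.
  exact: ltW.
have [p Fp] : exists p : H, F --> p.
  by have /cauchy_cvg Fcvg := Fc; apply: (@cvg_ex H _).1; exact: Fcvg.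
exists p; split.
  have FE : \forall y \near F, csub_set E y by exists 1 => //= y [].
  exact: (@closed_cvg _ _ _ FF id _ (@csub_closed _ _ E) FE p Fp).
move=> z Ez.
(* Moving [y] along [z] stays in [E], so the minimum given by [dotp_min] for [x - y] and [z] is
   still at least [D]. *)
have bnd y : csub_set E y -> `|dotp (x - y) z| ^+ 2 <= (q y - D%:C%C) * dotp z z.
  move=> Ey; have [->|z0] := eqVneq z 0.
    by rewrite !dotp0r normr0 expr0n mulr0.
  have zz : 0 < dotp z z by rewrite dotp_norm exprn_gt0 ?normr_gt0.
  rewrite -ler_pdivrMr// lerBrDl -lerBrDr -(dotp_min _ z0).
  set t := _ / _.
  rewrite -addrA -opprD -/(q _) -rqE lecR; apply: DV.
  by rewrite addrC; exact: csubP.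
(* Orthogonality follows from two limits along [F]: continuity gives [dotp (x - p) z], and [bnd]
   gives 0 because [q y] tends to [D]. *)
have lim1 : (fun y => dotp (x - y) z) @ F --> (dotp (x - p) z : R[i]^o).
  apply: (@cvg_comp _ _ _ (fun y => x - y) (fun y => dotp y z : R[i]^o)
    F (nbhs (x - p))); last exact: dotp_continuousl.
  by apply: cvgB => //; exact: cvg_cst.
have lim2 : (fun y => dotp (x - y) z) @ F --> (0 : R[i]^o).
  apply/cvgrPdist_lt => e e0.
  have rE : (complex.Re e)%:C%C = e by apply: RRe_real; exact: gtr0_real.
  have r0 : 0 < complex.Re e by rewrite -ltcR rE.
  pose s := complex.Re (dotp z z).
  have sE : s%:C%C = dotp z z by apply: RRe_real; exact/ger0_real/dotp_ge0.
  have s0 : 0 <= s by rewrite -lecR sE; exact: dotp_ge0.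
  have d0 : 0 < complex.Re e ^+ 2 / (s + 1).
    by rewrite divr_gt0// ?exprn_gt0// ltr_wpDl.
  exists (complex.Re e ^+ 2 / (s + 1)) => //= y [Ey ye].
  rewrite sub0r normrN -(@ltr_pXn2r _ 2)// ?nnegrE ?ltW//.
  apply: le_lt_trans (bnd _ Ey) _.
  rewrite -sE -rqE -rmorphB -rmorphM -rE -rmorphXn ltcR.
  apply: (@le_lt_trans _ _ ((complex.Re e ^+ 2 / (s + 1)) * s)).
    by rewrite ler_wpM2r// lerBlDl ltW.
  rewrite mulrAC ltr_pdivrMr ?ltr_wpDl//.
  by rewrite ltr_pM2l ?exprn_gt0// ltrDl.
exact: (cvg_unique _ lim1 lim2).
Qed.

Lemma orth_projP x : csub_set E (orth_proj E x) /\ orthocomp E (x - orth_proj E x).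
Proof.
by have [p pP] := orth_decomp_ex x; rewrite /orth_proj; case: xgetP => [_ -> //|/(_ p)].
Qed.

Lemma orth_projE x : csub_set E (orth_proj E x).
Proof. by have [] := orth_projP x. Qed.

Lemma orth_proj_orth x y : csub_set E y -> dotp (x - orth_proj E x) y = 0.
Proof. by have [_] := orth_projP x; exact. Qed.

(** The difference of two candidates lies in [E] and is also orthogonal to [E], hence is zero. *)
Lemma orth_proj_eq x p : csub_set E p -> orthocomp E (x - p) -> orth_proj E x = p.
Proof.
move=> Ep xp; apply/eqP; rewrite -subr_eq0; apply/eqP/dotp_eq0.
have Ed : csub_set E (orth_proj E x - p) by apply: csubB => //; exact: orth_projE.
have -> : dotp (orth_proj E x - p) (orth_proj E x - p) =
  dotp (x - p) (orth_proj E x - p) - dotp (x - orth_proj E x) (orth_proj E x - p).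
  by rewrite -dotpBl opprB [in RHS]addrC addrA subrK.
by rewrite xp// orth_proj_orth// subrr.
Qed.

Lemma orth_proj_linear : linear (orth_proj E).
Proof.
move=> a x y; apply: orth_proj_eq; first by apply: csubP; exact: orth_projE.
move=> z Ez; rewrite opprD addrACA -scalerBr dotpDl dotpZl.
by rewrite !orth_proj_orth// mulr0 addr0.
Qed.

Lemma orth_proj_norm x : `|orth_proj E x| <= `|x|.
Proof.
rewrite -(@ler_pXn2r _ 2)// ?nnegrE// -!dotp_norm.
have := orth_proj_orth x (orth_projE x); have := subrK (orth_proj E x) x.
move: (orth_proj E x) (x - orth_proj E x) => p r <- rp.
rewrite dotpDl !dotpDr rp (dotp_eq0C rp) addr0 add0r.
by rewrite lerDr; exact: dotp_ge0.
Qed.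

End Projection.

(** * Riesz representation and adjoints *)

Section Adjoint.
Context {R : realType} {H : hilbertType R}.
Implicit Types (x y z : H) (a : R[i]) (T : bop H).

Lemma bop_linear T : linear T.
Proof. by case: T => f /= /asboolP[]. Qed.

Lemma bop_le T : exists2 M : R[i], 0 <= M & forall x, `|T x| <= M * `|x|.
Proof.
case: T => f /= /asboolP[_ [M fM]]; exists `|M| => // x.
suff -> : `|M| * `|x| = M * `|x| by exact: fM.
by have /ger0_norm <- := le_trans (normr_ge0 _) (fM x); rewrite normrM normr_id.
Qed.

Lemma riesz (f : H -> R[i]) : scalar f -> continuous (f : H -> R[i]^o) ->
  exists w, forall x, f x = dotp x w.
Proof.
move=> fl fc.
have f0 : f 0 = 0.
  by have := fl (-1) 0 0; rewrite scaler0 addr0 mulN1r addNr.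
have Ksub : is_subspace (f @^-1` [set 0]).
  by split=> //= a x y fx fy; rewrite fl fx fy mulr0 addr0.
have Kcl : closed (f @^-1` [set 0]).
  move/continuous_closedP : fc; apply.
  by apply: accessible_closed_set1; apply: hausdorff_accessible; exact: norm_hausdorff.
pose K := CSub Ksub Kcl.
have [fK|/existsNP[x fx]] := pselect (forall x, f x = 0).
  by exists 0 => x; rewrite fK dotp0r.
pose z := x - orth_proj K x.
have fz : f z = f x.
  rewrite /z addrC -scaleN1r fl; have -> : f (orth_proj K x) = 0 := orth_projE K x.
  by rewrite mulr0 add0r.
have fz0 : f z != 0 by rewrite fz; apply/eqP.
have zz : dotp z z != 0.
  by apply: contra fz0 => /eqP/dotp_eq0 ->; rewrite f0.
(* Every [y] is a multiple of [z] plus an element of the kernel, which is orthogonal to [z]; the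
   scalar is fixed by requiring the value [f z] at [z]. *)
exists ((Num.conj (f z) / dotp z z) *: z) => y.
have : dotp z (y - (f y / f z) *: z) = 0.
  apply: orth_proj_orth.
  by rewrite /= addrC -scaleNr fl mulNr divfK// addNr.
move/dotp_eq0C; rewrite dotpBl dotpZl dotpZr => /subr0_eq ->.
rewrite rmorphM fmorphV /= conjCK -[Num.conj (dotp z z)]dotpC.
by field; apply/andP.
Qed.

Lemma bop_adjoint T : exists Ts : H -> H,
  (forall x y, dotp (T x) y = dotp x (Ts y)) /\
  exists2 M : R[i], 0 <= M & forall x, `|Ts x| <= M * `|x|.
Proof.
have [M M0 TM] := bop_le T.
have Tlin a x y : T (a *: x + y) = a *: T x + T y by exact: bop_linear.
have TB x y : T x - T y = T (x - y).
  by rewrite [LHS]addrC [x - y]addrC -(scaleN1r (T y)) -(scaleN1r y) Tlin.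
have ex y : exists w, forall x, dotp (T x) y = dotp x w.
  apply: riesz => [a u v|]; first by rewrite Tlin dotpDl dotpZl.
  move=> x; apply/cvgrPdist_lt => e e0.
  near=> t.
  rewrite -dotpBl TB; apply: le_lt_trans (cauchy_schwarz _ _) _.
  apply: le_lt_trans (ler_wpM2r _ (TM _)) _ => //.
  rewrite mulrAC; apply: (@le_lt_trans _ _ ((M * `|y| + 1) * `|x - t|)).
    by rewrite ler_wpM2r// lerDl.
  rewrite mulrC -ltr_pdivlMr ?ltr_wpDl ?mulr_ge0//.
  by near: t; apply: cvgr_dist_lt => //; rewrite divr_gt0 ?ltr_wpDl ?mulr_ge0.
have [Ts TsP] := choice ex; exists Ts; split=> [x y|]; first exact: TsP.
exists M => // y; have [->|Ty0] := eqVneq (Ts y) 0.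
  by rewrite normr0 mulr_ge0.
(* The squared norm of [Ts y] equals [dotp (T (Ts y)) y], which is at most [M] times the norms of
   [Ts y] and [y]; one factor then cancels. *)
rewrite -(@ler_pM2r _ `|Ts y|) ?normr_gt0// -expr2 -dotp_norm -TsP.
have -> : dotp (T (Ts y)) y = `|dotp (T (Ts y)) y|.
  by rewrite ger0_norm// TsP; exact: dotp_ge0.
apply: le_trans (cauchy_schwarz _ _) _.
by rewrite mulrAC ler_wpM2r.
Unshelve. all: by end_near. Qed.

End Adjoint.

(** * Comparison test, pointwise topology and closures *)

Lemma complex_series_le_cvg (R : realType) (a b : nat -> R[i]^o) :
  (forall n, `|a n| <= b n) -> cvgn (series b) -> cvgn (series a).
Proof.
move=> ab /cvg_cauchy/cauchy_seriesP bc; apply: complex_cauchy_cvg.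
apply/cauchy_seriesP => e e0; apply: filterS (bc _ e0) => -[m n] /=.
apply: le_lt_trans; apply: le_trans (ler_norm_sum _ _ _) _.
rewrite ger0_norm; first exact: ler_sum.
by apply: sumr_ge0 => k _; exact: le_trans (ab k).
Qed.

(** The pointwise topology is the supremum of the initial topologies of the evaluations, so
    continuity is tested one coordinate at a time. *)
Lemma ptws_continuous (X V : topologicalType) (I : Type)
    (f : X -> {ptws I -> V}) :
  (forall i, continuous (fun x => f x i)) -> continuous f.
Proof.
move=> fc x; apply/cvg_sup => i.
exact: (@continuous_comp_initial _ X _ (fun g : I -> V => g i) f (fc i) x).
Qed.

Lemma ptws_eval_continuous (V : topologicalType) (I : Type) (i : I) :
  continuous (fun f : {ptws I -> V} => f i).
Proof.
move=> f U fU.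
have /cvg_sup/(_ i) fi : nbhs (f : {ptws I -> V}) --> (f : {ptws I -> V}) by [].
by apply: fi; exact: (@initial_continuous _ V (fun g : I -> V => g i) f U fU).
Qed.

Lemma continuous_closure_sub (X Y : topologicalType) (f : X -> Y)
    (A : set X) (B : set Y) : continuous f ->
  (forall x, A x -> closure B (f x)) -> forall x, closure A x -> closure B (f x).
Proof.
move=> /continuous_closedP fc AB x /(closureS (AB : A `<=` f @^-1` closure B)).
have /closure_id <- // : closed (f @^-1` closure B).
by apply: fc; exact: closed_closure.
Qed.

(** One argument is moved to the closure at a time, so separate continuity suffices; the operator
    product is in general not jointly weak* continuous. *)
Lemma closure_op (X : topologicalType) (op : X -> X -> X) (C : set X) :
  (forall x, continuous (op x)) -> (forall y, continuous (op^~ y)) ->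
  (forall x y, C x -> C y -> C (op x y)) ->
  forall x y, closure C x -> closure C y -> closure C (op x y).
Proof.
move=> cl cr CC x y Cx Cy.
apply: (continuous_closure_sub (cr y)) (Cx) => {Cx}x Cx.
by apply: (continuous_closure_sub (cl x)) (Cy) => {Cy}y Cy; apply/subset_closure/CC.
Qed.

(** * The weak* topology and weak* closures of operator algebras *)

Section WeakStar.
Context {R : realType} {H : hilbertType R}.
Implicit Types (S T : bop H) (A : set (bop H)).
Local Notation l2 := (@l2seq R H).

(** Stated for a mere function with a norm bound, since [bop_adjoint] supplies the adjoint in that
    form. *)
Lemma l2_map (f : H -> H) (M : R[i]) : 0 <= M ->
  (forall x, `|f x| <= M * `|x|) ->
  forall u : l2, cvgn (series (fun n => `|f (sval u n)| ^+ 2)).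
Proof.
move=> M0 fM [u uc] /=.
apply: (@complex_series_le_cvg _ _ (M ^+ 2 *: (fun n => `|u n| ^+ 2 : R[i]^o))).
  move=> n; rewrite ger0_norm ?exprn_ge0//.
  rewrite [leRHS](_ : _ = M ^+ 2 * `|u n| ^+ 2)// -exprMn.
  by rewrite ler_pXn2r ?nnegrE ?mulr_ge0.
exact: is_cvg_seriesZ.
Qed.

(** Guarantees that [limn] in [predual_eval] is a genuine limit, hence linear in the operator. *)
Lemma predual_cvg T (uv : l2 * l2) :
  cvgn (series (fun n => dotp (T (sval uv.1 n)) (sval uv.2 n) : R[i]^o)).
Proof.
case: uv => u v /=; have [M M0 TM] := bop_le T.
apply: (@complex_series_le_cvg _ _
  ((fun n => `|T (sval u n)| ^+ 2 : R[i]^o) + (fun n => `|sval v n| ^+ 2 : R[i]^o))).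
  move=> n; apply: le_trans (cauchy_schwarz _ _) _.
  set s := `|_|; set t := `|_|; have s0 : 0 <= s := normr_ge0 _.
  have t0 : 0 <= t := normr_ge0 _.
  rewrite [leRHS](_ : _ = s ^+ 2 + t ^+ 2)//.
  (* The product [s * t] is at most the square of the larger factor. *)
  have [st|/ltW ts] := real_leP (normr_real (T (sval u n))) (normr_real (sval v n)).
    by rewrite -[leLHS]add0r; apply: lerD; rewrite ?exprn_ge0// expr2 ler_wpM2r.
  by rewrite -[leLHS]addr0; apply: lerD; rewrite ?exprn_ge0// expr2 ler_wpM2l.
apply: is_cvg_seriesD; last by case: v.
exact: l2_map TM u.
Qed.

Lemma predual_eval_linear (a : R[i]) S T uv :
  predual_eval (a *: S + T) uv = a * predual_eval S uv + predual_eval T uv.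
Proof.
have cS := @predual_cvg S uv; have cT := @predual_cvg T uv.
have := lim_seriesD (is_cvg_seriesZ (k := a) cS) cT; rewrite (lim_seriesZ a cS) => <-.
congr (limn (series _)); apply/funext => n.
by rewrite [LHS]dotpDl dotpZl.
Qed.

Lemma predual_eval_continuous uv :
  continuous (fun T : weak_star H => predual_eval T uv).
Proof.
move=> T; apply: (@continuous_comp _ _ _ (@predual_eval R H : weak_star H -> _)
  (fun f : {ptws l2 * l2 -> R[i]^o} => f uv)).
  exact: initial_continuous.
exact: ptws_eval_continuous.
Qed.

(** Each predual functional composed with [g] is affine in another predual functional; the constant
    [c] accommodates translations. *)
Lemma weak_star_continuous (g : weak_star H -> weak_star H) :
  (forall uv, exists a uv' c, forall T,
    predual_eval (g T) uv = a * predual_eval T uv' + c) ->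
  continuous g.
Proof.
move=> gP; apply: continuous_comp_initial; apply: ptws_continuous => uv.
have [a [uv' [c gE]]] := gP uv.
rewrite (_ : (fun T => _) = fun T : weak_star H => a *: predual_eval T uv' + c);
  last exact/funext.
move=> T; have pT := @predual_eval_continuous uv' T.
exact: cvgD (cvgZl_tmp (k := a) pT) (cvg_cst c).
Qed.

(* T |-> S T is weak* continuous because <S T u, v> = <T u, S^* v>. *)
Lemma closure_dual_operator_algebra A : is_subspace A ->
  (forall S T, A S -> A T -> A (bop_comp S T)) ->
  dual_operator_algebra (closure (A : set (weak_star H)) : set (bop H)).
Proof.
move=> [A0 Alin] Acomp; split; last exact: (@closed_closure (weak_star H)).
  split; first exact: (@subset_closure (weak_star H)).
  move=> a; apply: (@closure_op (weak_star H) (fun S T : bop H => a *: S + T)).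
  - move=> S; apply: weak_star_continuous => uv.
    exists 1, uv, (a * predual_eval S uv) => T.
    by rewrite predual_eval_linear mul1r addrC.
  - move=> T; apply: weak_star_continuous => uv.
    exists a, uv, (predual_eval T uv) => S; exact: predual_eval_linear.
  - exact: Alin.
apply: (@closure_op (weak_star H) (fun S T : bop H => bop_comp S T)) => //.
- move=> S; apply: weak_star_continuous => -[u v].
  have [Ss [SsP [M M0 SsM]]] := bop_adjoint S.
  pose v' : l2 := exist _ (fun n => Ss (sval v n)) (@l2_map Ss M M0 SsM v).
  exists 1, (u, v'), 0 => T; rewrite mul1r addr0.
  by congr (limn (series _)); apply/funext => n /=; exact: SsP.
(* Right multiplication by [T] is absorbed into the first sequence. *)
- move=> T; apply: weak_star_continuous => -[u v].
  have [M M0 TM] := bop_le T.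
  pose u' : l2 := exist _ (fun n => T (sval u n)) (@l2_map T M M0 TM u).
  by exists 1, (u', v), 0 => S; rewrite mul1r addr0.
Qed.

End WeakStar.

(** * Closed subspaces: spans, intersections and compressions *)

Section ClosedSubspaces.
Context {R : realType} {H : hilbertType R}.
Implicit Types (S : set H) (E F : csub H) (T : bop H).

Lemma csub_eq E F : (E : set H) = F -> E = F.
Proof.
case: E F => [E Es Ec] [F Fs Fc] /= EF; rewrite EF in Es Ec *.
by rewrite (Prop_irrelevance Es Fs) (Prop_irrelevance Ec Fc).
Qed.

Lemma orthocomp_subspace S : is_subspace (orthocomp S).
Proof.
split=> [y _|a x y xS yS z Sz]; first exact: dotp0l.
by rewrite dotpDl dotpZl xS// yS// mulr0 addr0.
Qed.

Lemma orthocomp_closed S : closed (orthocomp S).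
Proof.
have -> : orthocomp S =
    \bigcap_(y in S) ((fun x => dotp x y : R[i]^o) @^-1` [set 0]) by [].
apply: closed_bigI => y _; have /continuous_closedP := @dotp_continuousl R H y.
apply; apply: accessible_closed_set1; apply: hausdorff_accessible.
exact: norm_hausdorff.
Qed.

Definition csub_orthocomp S : csub H :=
  CSub (orthocomp_subspace S) (@orthocomp_closed S).

(** The closed linear span as a double orthogonal complement, which makes linearity and closedness
    immediate. *)
Definition csub_span S : csub H := csub_orthocomp (orthocomp S).

Lemma sub_csub_span S : S `<=` csub_span S.
Proof. by move=> x Sx y yS; apply: dotp_eq0C; exact: yS. Qed.

(** For [x] in the span, [x - orth_proj E x] is orthogonal to [S], hence to [x], and also to
    [orth_proj E x]; so it vanishes. *)
Lemma csub_span_min S E : S `<=` E -> csub_span S `<=` E.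
Proof.
move=> SE x xS; have Ep := orth_projE E x.
have xp : orthocomp S (x - orth_proj E x).
  by move=> s /SE; exact: orth_proj_orth.
suff /dotp_eq0/subr0_eq -> : dotp (x - orth_proj E x) (x - orth_proj E x) = 0 by [].
by rewrite dotpBl (xS _ xp) sub0r (dotp_eq0C (orth_proj_orth x Ep)) oppr0.
Qed.

(** By duality: the adjoint of [T] maps the orthogonal complement of [S] into itself. *)
Lemma csub_span_stable S T : (forall x, S x -> csub_set (csub_span S) (T x)) ->
  T @` (csub_span S : set H) `<=` csub_span S.
Proof.
move=> TS _ [x xS <-] y yS; have [Ts [TsP _]] := bop_adjoint T.
rewrite TsP; apply: xS => s Ss; apply: dotp_eq0C; rewrite -TsP.
exact: TS yS.
Qed.

Lemma bigcap_subspace (N : set (csub H)) :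
  is_subspace (\bigcap_(E in N) (E : set H)).
Proof.
split=> [E _|a x y xN yN E NE]; first exact: csub0.
by apply: csubP; [exact: xN|exact: yN].
Qed.

Lemma bigcap_csub_closed (N : set (csub H)) :
  closed (\bigcap_(E in N) (E : set H)).
Proof. by apply: closed_bigI => E _; exact: csub_closed. Qed.

Definition csub_bigcap (N : set (csub H)) : csub H :=
  CSub (bigcap_subspace N) (@bigcap_csub_closed N).

Lemma setI_subspace E F : is_subspace ((E : set H) `&` F).
Proof.
split=> [|a x y [Ex Fx] [Ey Fy]]; first by split; exact: csub0.
by split; exact: csubP.
Qed.

Lemma setI_csub_closed E F : closed ((E : set H) `&` F).
Proof. by apply: closedI; exact: csub_closed. Qed.

Definition csub_setI E F : csub H :=
  CSub (setI_subspace E F) (@setI_csub_closed E F).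

Lemma compression_ex E T : exists S : bop (csub_sort E),
  forall x, csub_val (S x) = orth_proj E (T (csub_val x)).
Proof.
have PE (x : csub_sort E) : orth_proj E (T (csub_val x)) \in csub_pred E.
  by rewrite inE; exact: orth_projE.
pose f (x : csub_sort E) : csub_sort E := CSubSort (PE x).
have fb : f \in @bounded_op R (csub_sort E).
  apply/asboolP; split=> [a x y|].
    apply: val_inj => /=; rewrite -orth_proj_linear; congr (orth_proj E _).
    exact: bop_linear.
  have [M M0 TM] := bop_le T; exists M => x.
  exact: le_trans (orth_proj_norm _ _) (TM _).
by exists (Bop fb).
Qed.

End ClosedSubspaces.

(** * Subquotients and the lifting of their invariant subspaces *)

Section Subquotient.
Context {R : realType} {H : hilbertType R} (A : set (bop H)).
Variables E1 E2 : csub H.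
Hypotheses (hA : dual_operator_algebra A)
  (inv1 : invariant_subspace A E1) (inv2 : invariant_subspace A E2)
  (E21 : E2 `<=` E1).

Definition csub_diff : csub H := csub_setI E1 (csub_orthocomp E2).
Local Notation E := csub_diff.

Lemma csub_diff_semi_invariant : semi_invariant A E.
Proof. by exists E1, E2. Qed.

Lemma orth_proj_diff0 x : csub_set E2 x -> orth_proj E x = 0.
Proof.
move=> E2x; apply: orth_proj_eq; first exact: csub0.
by move=> y [_ yE2]; rewrite subr0; apply: dotp_eq0C; exact: yE2.
Qed.

(** On [E1] the projection onto [E] is the identity minus the projection onto [E2]. *)
Lemma sub_orth_proj_diff x : csub_set E1 x -> csub_set E2 (x - orth_proj E x).
Proof.
move=> E1x; have E2p := orth_projE E2 x.
rewrite (@orth_proj_eq _ _ E x (x - orth_proj E2 x)).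
- by rewrite opprB addrC subrK.
- by split; [apply: csubB => //; exact: E21|move=> y; exact: orth_proj_orth].
- move=> y [_ yE2]; rewrite opprB addrC subrK.
  by apply: dotp_eq0C; exact: yE2.
Qed.

Lemma compression_subspace : is_subspace (compression A E).
Proof.
have [[A0 Alin] _ _] := hA; split.
  exists 0 => // x; apply/esym/orth_proj_eq; first exact: csub0.
  by move=> y _; rewrite subrr dotp0l.
move=> a S1 S2 [T1 A1 ST1] [T2 A2 ST2]; exists (a *: T1 + T2); first exact: Alin.
by move=> x; rewrite [RHS]orth_proj_linear -ST1 -ST2.
Qed.

(** Semi-invariance makes compression multiplicative: [T2] maps [E] into [E1], where cutting down to
    [E] loses only a vector of [E2]; [T1] keeps that vector in [E2], and the projection kills it. *)
Lemma compression_comp S1 S2 : compression A E S1 -> compression A E S2 ->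
  compression A E (bop_comp S1 S2).
Proof.
have [_ Acomp _] := hA.
move=> [T1 A1 ST1] [T2 A2 ST2]; exists (bop_comp T1 T2); first exact: Acomp.
move=> x; rewrite /= ST1 ST2; set y := T2 _.
have E1y : csub_set E1 y.
  apply: (inv1 A2); exists (csub_val x) => //.
  by have := csub_valP x; rewrite inE => -[].
have E2T : csub_set E2 (T1 (y - orth_proj E y)).
  by apply: (inv2 A1); exists (y - orth_proj E y) => //; exact: sub_orth_proj_diff.
rewrite -[in RHS](subrK (orth_proj E y) y) -[X in T1 (X + _)]scale1r bop_linear.
by rewrite orth_proj_linear (orth_proj_diff0 E2T) scaler0 add0r.
Qed.

Lemma subquotient_dual_operator_algebra :
  dual_operator_algebra (subquotient A E).
Proof.
apply: closure_dual_operator_algebra; first exact: compression_subspace.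
exact: compression_comp.
Qed.

Lemma intermediate_invariant_subspace (hfull : no_full_subquotient_dim_gt1 A)
    (hTAP : transitive_algebra_problem_positive R) : dim_gt1 (csub_sort E) ->
  exists K : csub H, [/\ invariant_subspace A K, E2 `<=` K, K `<=` E1,
    ~ (K `<=` E2) & ~ (E1 `<=` K)].
Proof.
move=> dimE; have properE : subquotient A E `<` setT.
  split=> // TE.
  apply: (hfull _ csub_diff_semi_invariant dimE).
  by apply/seteqP; split.
have [G [invG /eqP G0 GT]] :=
  hTAP _ _ dimE subquotient_dual_operator_algebra properE.
pose G' : set H := @csub_val _ _ E @` (G : set (csub_sort E)).
pose K := csub_span ((E2 : set H) `|` G').
have E2K : E2 `<=` K by move=> x E2x; apply: sub_csub_span; left.
have G'K : G' `<=` K by move=> x G'x; apply: sub_csub_span; right.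
have E_E1 (x : csub_sort E) : csub_set E1 (csub_val x).
  by have := csub_valP x; rewrite inE => -[].
have E_E2 (x : csub_sort E) : orthocomp E2 (csub_val x).
  by have := csub_valP x; rewrite inE => -[].
exists K; split => //.
- move=> T AT; apply: csub_span_stable => x [E2x|[g Gg <-]].
    by apply: E2K; apply: (inv2 AT); exists x.
  (* [T g] splits into a vector of [E2] and its projection to [E], which is [S g] and stays in [G]
     because [S] belongs to the subquotient. *)
  have [S ST] := compression_ex E T.
  have E1Tg : csub_set E1 (T (csub_val g)).
    by apply: (inv1 AT); exists (csub_val g).
  rewrite -(subrK (orth_proj E (T (csub_val g))) (T (csub_val g))).
  apply: csubD; first exact/E2K/sub_orth_proj_diff.
  rewrite -ST; apply: G'K; exists (S g) => //; apply: (invG S); last by exists g.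
  by apply: (@subset_closure (weak_star (csub_sort E))); exists T.
- by apply: csub_span_min => x [/E21//|[g _ <-]].
(* Otherwise each vector of [G] lies in [E2] and is orthogonal to it, so [G] is zero. *)
- move=> KE2; move/eqP : G0; apply; apply/seteqP; split => [g Gg|_ ->].
    have /E_E2 gg : csub_set E2 (csub_val g) by apply: KE2; apply: G'K; exists g.
    by apply: dotp_eq0; exact: gg.
  exact: csub0.
(* For [w] in [E], the remainder [w - orth_proj G w] is orthogonal to [E2] and to [G], hence to [K].
   If [K] contains [E1], it is orthogonal to [w] too, so it vanishes and [G] is all of [E]. *)
- move=> E1K; apply: GT; apply/seteqP; split => // w _.
  have Gq := orth_projE G w.
  have Gr (g : csub_sort E) : csub_set G g -> dotp (w - orth_proj G w) g = 0.
    exact: orth_proj_orth.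
  have rK : dotp w (w - orth_proj G w) = 0.
    apply: (E1K _ (E_E1 w)) => y [|[g Gg <-]]; last exact: Gr.
    exact: E_E2.
  suff /dotp_eq0/subr0_eq -> : dotp (w - orth_proj G w) (w - orth_proj G w) = 0 by [].
  by rewrite dotpBl rK sub0r (dotp_eq0C (Gr _ Gq)) oppr0.
Qed.

End Subquotient.

(** * Gaps in nests of invariant subspaces *)

Lemma dim_gt1_csub_diff (R : realType) (H : hilbertType R) (E1 E2 F : csub H) :
  E2 `<=` F -> F `<=` E1 -> ~ (F `<=` E2) -> ~ (E1 `<=` F) ->
  dim_gt1 (csub_sort (csub_diff E1 E2)).
Proof.
move=> E2F FE1 /existsNP[x /not_implyP[Fx E2x]] /existsNP[y /not_implyP[E1y Fy]].
(* [u] lies in [F] and is orthogonal to [E2], [v] lies in [E1] and is orthogonal to [F]: two nonzero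
   orthogonal vectors of the difference. *)
pose u := x - orth_proj E2 x; pose v := y - orth_proj F y.
have Fu : csub_set F u by apply: csubB => //; exact/E2F/orth_projE.
have Eu : u \in csub_pred (csub_diff E1 E2).
  by rewrite inE; split; [exact: FE1|move=> z; exact: orth_proj_orth].
have Ev : v \in csub_pred (csub_diff E1 E2).
  rewrite inE; split; first by apply: csubB => //; exact/FE1/orth_projE.
  by move=> z /E2F; exact: orth_proj_orth.
have vu : dotp v u = 0 by exact: orth_proj_orth.
have u0 : dotp u u != 0.
  apply/eqP => /dotp_eq0/subr0_eq xE; apply: E2x; rewrite xE; exact: orth_projE.
have v0 : dotp v v != 0.
  apply/eqP => /dotp_eq0/subr0_eq yF; apply: Fy; rewrite yF; exact: orth_projE.
exists (CSubSort Eu), (CSubSort Ev) => a b.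
move=> /(congr1 (@csub_val _ _ (csub_diff E1 E2))) /= ab.
have ab0 : a *: u + b *: v = 0 by [].
split; apply/eqP.
  have := congr1 (fun z => dotp z u) ab0; rewrite dotpDl !dotpZl vu mulr0 addr0 dotp0l.
  by move/eqP; rewrite mulf_eq0 (negPf u0) orbF.
have := congr1 (fun z => dotp z v) ab0.
rewrite dotpDl !dotpZl (dotp_eq0C vu) mulr0 add0r dotp0l.
by move/eqP; rewrite mulf_eq0 (negPf v0) orbF.
Qed.

Lemma maximal_invariant_nest_ex (R : realType) (H : hilbertType R)
    (A : set (bop H)) : exists N : set (csub H),
  [/\ nest N, upper_triangular A N & forall K, invariant_subspace A K ->
    (forall E, N E -> E `<=` K \/ K `<=` E) -> N K].
Proof.
have [F FP tF|N [[nN uN] maxN]] :=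
  @Zorn_bigcup (csub H) (fun N => nest N /\ upper_triangular A N).
  split=> [E1 E2 [N1 F1 N1E] [N2 F2 N2E]|E [N /FP[_ uN] NE]]; last exact: uN.
  have [N12|N21] := tF _ _ F1 F2.
    by have [nN _] := FP _ F2; apply: nN => //; exact: N12.
  by have [nN _] := FP _ F1; apply: nN => //; exact: N21.
exists N; split => // K invK KN; apply: contrapT => NK.
(* Adjoining [K] would give a strictly larger nest of invariant subspaces. *)
apply: (maxN (K |` N)).
  by split=> [E NE|/(_ K (or_introl erefl))//]; right.
split=> [E1 E2 [->|N1] [->|N2]|E [->//|]]; last exact: uN.
- by left.
- by have [] := KN _ N2; [right|left].
- exact: KN.
- exact: nN.
Qed.

Theorem theorem8p2 (R : realType) (H : hilbertType R) (A : set (bop H))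
    (hA : dual_operator_algebra A)
    (hfull : no_full_subquotient_dim_gt1 A)
    (hTAP : transitive_algebra_problem_positive R) :
  exists N : set (csub H), maximal_nest N /\ upper_triangular A N.
Proof.
have [N [nN uN addN]] := maximal_invariant_nest_ex A.
exists N; split => //; split => // M nM NM; apply/seteqP; split => // F MF.
(* If no member of [N] lies above [F], then [E1] is the whole space; if none lies below, [E2] is
   zero. *)
pose E1 := csub_bigcap [set E | N E /\ F `<=` E].
pose E2 := csub_span (\bigcup_(E in [set E | N E /\ E `<=` F]) (E : set H)).
have FE1 : F `<=` E1 by move=> x Fx E [_]; exact.
have E2F : E2 `<=` F by apply: csub_span_min => x [E [_ EF]]; exact: EF.
(* Members of [N] are comparable with [F] through [M], so none lies strictly between [E2] and
   [E1]. *)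
have NF E : N E -> E `<=` E2 \/ E1 `<=` E.
  move=> NE; have [EF|FE] := nM _ _ (NM _ NE) MF.
    by left => x Ex; apply: sub_csub_span; exists E.
  by right => x; exact.
have inv1 : invariant_subspace A E1.
  move=> T AT _ [x E1x <-] E NE; apply: (uN _ NE.1 _ AT).
  by exists x => //; exact: E1x.
have inv2 : invariant_subspace A E2.
  move=> T AT; apply: csub_span_stable => x [E NE Ex].
  apply: sub_csub_span; exists E => //; apply: (uN _ NE.1 _ AT).
  by exists x.
have E21 : E2 `<=` E1 by exact: subset_trans FE1.
(* By [NF] such a [K] is comparable with all of [N]. Applied to [E1] and [E2] themselves, this
   settles the cases where [F] is one of them. *)
have between K : invariant_subspace A K -> E2 `<=` K -> K `<=` E1 -> N K.
  move=> invK E2K KE1; apply: addN => // E /NF[EE2|E1E].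
    by left; exact: subset_trans E2K.
  by right; exact: subset_trans E1E.
have [FE2|FE2] := pselect (F `<=` E2).
  have -> : F = E2 by apply: csub_eq; apply/seteqP; split.
  exact: between.
have [E1F|E1F] := pselect (E1 `<=` F).
  have -> : F = E1 by apply: csub_eq; apply/seteqP; split.
  exact: between.
have dimE := dim_gt1_csub_diff E2F FE1 FE2 E1F.
have [K [invK E2K KE1 KE2 E1K]] :=
  intermediate_invariant_subspace hA inv1 inv2 E21 hfull hTAP dimE.
(* The intermediate [K] would belong to [N], against the gap [NF]. *)
by have [/KE2|/E1K] := NF _ (between _ invK E2K KE1).
Qed.
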